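(* Let $m\ge 2$ and let $\mathcal{F}$ be a family of subsets of $[n]$. Assume that there are no $m+2$ different sets $A,B_1,B_2,\dots,B_m,C\in\mathcal{F}$ such that $A\subset B_i\subset C$ for all $1\le i\le m$ and $|B_1|=|B_2|=\dots=|B_m|$. Then $$|\mathcal{F}|\le 3\left(\lceil\log_3(m-1)\rceil+1\right)\binom{n}{\lfloor\frac{n}{2}\rfloor}.$$
   Context: $[n]=\{1,2,\dots,n\}$. *)

(* Defs.v *)
From mathcomp Require Import all_boot.

Set Implicit Arguments.
Unset Strict Implicit.
Unset Printing Implicit Defensive.

(* [n] = {1, ..., n} is modelled by 'I_n = {0, ..., n - 1}.  As the m + 2 sets
   are distinct, the non-strict inclusions below are necessarily strict. *)
Definition has_level_diamond (n m : nat) (F : {set {set 'I_n}}) : Prop :=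
  exists (A C : {set 'I_n}) (B : m.-tuple {set 'I_n}),
    [/\ uniq (A :: rcons B C),
        {subset A :: rcons B C <= F},
        forall i : 'I_m, A \subset tnth B i /\ tnth B i \subset C
      & forall i j : 'I_m, #|tnth B i| = #|tnth B j| ].

(* Main.v *)
(* Count pairs (s, B) where the permutation s encodes a full chain passing
   through B in F, and put k = up_log 3 (m - 1).  Group the chains by the least
   and the greatest member A, C of F they contain.  Each class is invariant under
   shuffling the elements of C :\: A, so the average number of members of F on its
   chains is at most the sum over i <= d = #|C :\: A| of a_i / 'C(d, i), where a_i
   counts the members of F at level i of [A, C].  There a_i <= 'C(d, i), and
   a_i <= m - 1 <= 3 ^ k for 0 < i < d.  If d < 3(k + 1) the sum is at most
   d + 1 <= 3(k + 1).  Otherwise the levels i <= k and i >= d - k contribute at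
   most 2(k + 1), and each of the d - 2k - 1 middle levels at most
   3 ^ k / 'C(d, k + 1) <= (k + 1) / (d - k), so k + 1 in total. *)
Require Import Defs.
From mathcomp Require Import all_boot all_fingroup.
From mathcomp Require Import zify.

Set Implicit Arguments.
Unset Strict Implicit.
Unset Printing Implicit Defensive.

(** * Binomial estimates and the sum over levels *)

Lemma leq_bin_lower_half n i j : i <= j -> j.*2 <= n -> 'C(n, i) <= 'C(n, j).
Proof.
elim: j => [|j IHj]; first by rewrite leqn0 => /eqP->.
rewrite leq_eqVlt => /predU1P[->//|]; rewrite ltnS => ij jn.
apply: (leq_trans (IHj ij _)); first lia.
rewrite -(leq_pmul2l (ltn0Sn j)) mul_bin_left leq_mul2r; lia.
Qed.

(** Past the middle, symmetry replaces [j] by [n - j], which is still at least [i] because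
    [i + j <= n]. *)
Lemma leq_bin_central n i j : i <= j -> i + j <= n -> 'C(n, i) <= 'C(n, j).
Proof.
move=> ij ijn; have [jn|jn] := leqP j.*2 n; first exact: leq_bin_lower_half.
rewrite -(@bin_sub n j); last lia.
by apply: leq_bin_lower_half; lia.
Qed.

Lemma leq_bin_half n i : i <= n -> 'C(n, i) <= 'C(n, n %/ 2).
Proof.
move=> ni; have [h|h] := leqP i.*2 n.
  by apply: leq_bin_lower_half; lia.
by rewrite -(@bin_sub n i) //; apply: leq_bin_lower_half; lia.
Qed.

(** Passing from ['C(d, k)] to ['C(d.+1, k.+1)] multiplies by [d.+1 / k.+1], which is at least 3 in
    this range. *)
Lemma exp3_leq_bin d k : 3 * k <= d -> 3 ^ k <= 'C(d, k).
Proof.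
elim: k d => [|k IHk] d kd; first by rewrite bin0.
case: d kd => [|d] kd; first lia.
rewrite -(leq_pmul2l (ltn0Sn k)) -mul_bin_diag expnS mulnA.
by apply: leq_mul; [lia | apply: IHk; lia].
Qed.

(** The least binomial in this range is the one at [k.+1], and
    [k.+1 * 'C(d, k.+1) = (d - k) * 'C(d, k)]. *)
Lemma middle_bin_lower_bound d k i :
  3 * k.+1 <= d -> k < i < d - k -> 3 ^ k * (d - k) <= k.+1 * 'C(d, i).
Proof.
move=> kd /andP[ki id].
apply: (@leq_trans (k.+1 * 'C(d, k.+1))).
  by rewrite mul_bin_left mulnC leq_mul2l exp3_leq_bin ?orbT //; lia.
by rewrite leq_mul2l leq_bin_central ?orbT //; lia.
Qed.

(** Applied with [d = #|C :\: A|], [M] the factorial of [d], and [x i] the number of incidences at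
    level [i]; scaling by [M] avoids division. *)
Lemma level_sum_bound d k M (x : nat -> nat) :
  (forall i, i <= d -> x i <= M) ->
  (3 * k.+1 <= d -> forall i, k < i < d - k -> (d - k) * x i <= k.+1 * M) ->
  \sum_(0 <= i < d.+1) x i <= 3 * k.+1 * M.
Proof.
move=> xM xmid.
have outer a b : b <= d.+1 -> \sum_(a <= i < b) x i <= (b - a) * M.
  move=> bd; rewrite -sum_nat_const_nat big_nat_cond [X in _ <= X]big_nat_cond.
  by apply: leq_sum => i /andP[/andP[_ ib] _]; apply: xM; lia.
have [dk|kd] := ltnP d (3 * k.+1).
  by apply: leq_trans (outer _ _ (leqnn _)) _; rewrite leq_mul2r; lia.
rewrite (@big_cat_nat _ _ _ k.+1) //=; last lia.
rewrite (@big_cat_nat _ _ _ (d - k) k.+1) //=; try lia.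
(* There are at most [d - k] middle levels, which cancels the factor [d - k] of [xmid]. *)
have inner : \sum_(k.+1 <= i < d - k) x i <= k.+1 * M.
  have dk0 : 0 < d - k by lia.
  rewrite -(leq_pmul2l dk0) big_distrr /=.
  apply: (@leq_trans (\sum_(k.+1 <= i < d - k) k.+1 * M)).
    rewrite big_nat_cond [X in _ <= X]big_nat_cond.
    by apply: leq_sum => i /andP[ik _]; apply: xmid.
  by rewrite sum_nat_const_nat leq_mul2r; lia.
have h1 := outer 0 k.+1 ltac:(lia).
have h2 := outer (d - k) d.+1 (leqnn _).
have h3 : (d.+1 - (d - k)) * M = k.+1 * M by congr (_ * _); lia.
nia.
Qed.

(** * Permutations supported on a set, acting on its subsets *)

Section PermImages.

Variable T : finType.
Implicit Types (D X Y Z : {set T}) (p : {perm T}).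

(** Swapping a point of [X :\: Y] with one of [Y :\: X] shrinks [X :\: Y]; the induction is on a
    bound [r] for its size. *)
Lemma perm_on_transitive D X Y :
  X \subset D -> Y \subset D -> #|X| = #|Y| ->
  exists2 p : {perm T}, perm_on D p & p @: X = Y.
Proof.
move=> XD YD; move: {2}#|X :\: Y| (leqnn #|X :\: Y|) => r.
elim: r X XD => [|r IHr] X XD.
  rewrite leqn0 cards_eq0 setD_eq0 => XY eXY.
  exists 1%g; first exact: perm_on1.
  rewrite (eq_imset (g := id)) => [|x]; last exact: perm1.
  by rewrite imset_id; apply/eqP; rewrite eqEcard XY eXY leqnn.
move=> Xr eXY.
have [XY0|[x xXY]] := set_0Vmem (X :\: Y); first by apply: IHr; rewrite ?XY0 ?cards0.
have eD : #|Y :\: X| = #|X :\: Y| by rewrite !cardsD eXY setIC.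
have [y yYX] : exists y, y \in Y :\: X.
  by apply/set0Pn; rewrite -card_gt0 eD card_gt0; apply/set0Pn; exists x.
move: (xXY) (yYX); rewrite !inE => /andP[xY xX] /andP[yX yY].
have tD : perm_on D (tperm x y).
  apply/subsetP => z; rewrite inE.
  by case: tpermP => [-> _|-> _|]; rewrite ?eqxx ?(subsetP XD x) ?(subsetP YD y).
set X' := tperm x y @: X.
have X'D : X' \subset D by rewrite -(im_perm_on tD) imsetS.
have X'Y : X' :\: Y \subset (X :\: Y) :\ x.
  apply/subsetP => z; rewrite !inE => /andP[zY /imsetP[w wX zw]].
  move: zw zY; case: tpermP => [_ ->|wy|wx wy ->]; first by rewrite yY.
    by rewrite wy (negPf yX) in wX.
  by move=> ->; rewrite wX !andbT; apply/eqP.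
have [||p pD pX'] := IHr X' X'D.
- apply: leq_trans (subset_leq_card X'Y) _.
  by move: Xr; rewrite (cardsD1 x) xXY.
- by rewrite card_imset //; exact: perm_inj.
exists (tperm x y * p)%g; first exact: perm_onM.
rewrite -pX' /X' -imset_comp; apply: eq_imset => z; exact: permM.
Qed.

Definition perms_onto D X Y := [set p : {perm T} | perm_on D p & p @: X == Y].

(** Right translation by a permutation of [D] taking [Y] to [Z] is an injection. *)
Lemma leq_card_perms_onto D X Y Z :
  Y \subset D -> Z \subset D -> #|Y| = #|Z| ->
  #|perms_onto D X Y| <= #|perms_onto D X Z|.
Proof.
move=> YD ZD eYZ; have [t tD tYZ] := perm_on_transitive YD ZD eYZ.
rewrite -(card_imset _ (mulIg t)); apply/subset_leq_card/subsetP => _ /imsetP[p + ->].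
rewrite !inE => /andP[pD /eqP pX]; rewrite perm_onM //=; apply/eqP.
by rewrite -tYZ -pX -imset_comp; apply: eq_imset => z; rewrite permM.
Qed.

(** Sort the permutations of [D] by the image of [X]: every subset of [D] of that size occurs, and
    all classes have equal size. *)
Lemma card_perms_onto D X Y :
  X \subset D -> Y \subset D -> #|X| = #|Y| ->
  #|perms_onto D X Y| * 'C(#|D|, #|X|) = #|D|`!.
Proof.
move=> XD YD eXY; rewrite -card_perm -[RHS]sum1_card.
rewrite (partition_big (fun p : {perm T} => p @: X)
          (mem [set Z : {set T} | Z \subset D & #|Z| == #|X|])) /=; last first.
  move=> p pD; rewrite inE -{1}(im_perm_on pD) imsetS //=.
  by rewrite card_imset //; exact: perm_inj.
rewrite -cards_draws mulnC -sum_nat_const; apply: eq_bigr => Z.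
rewrite inE => /andP[ZD /eqP eZX]; rewrite sum1dep_card.
by apply/eqP; rewrite eqn_leq !leq_card_perms_onto // -eXY.
Qed.

Lemma im_perm_on_disjoint D p X : perm_on D p -> [disjoint X & D] -> p @: X = X.
Proof.
move=> pD XD; rewrite -[RHS]imset_id; apply: eq_in_imset => x xX.
by rewrite (out_perm pD) // (disjointFr XD).
Qed.

Lemma im_perm_on_super D p X : perm_on D p -> D \subset X -> p @: X = X.
Proof. by move=> pD DX; apply: im_perm_on; apply: subset_trans DX. Qed.

End PermImages.

Lemma sum_bool_card (I : finType) (P Q : pred I) :
  \sum_(i | P i) Q i = #|[set i | P i & Q i]|.
Proof.
by rewrite -sum1dep_card big_mkcondr; apply: eq_bigr => i _; case: (Q i).
Qed.

(** * Full chains encoded by permutations *)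

Section FullChains.

Variable n : nat.
Implicit Types (s p : 'S_n) (A B C : {set 'I_n}) (F : {set {set 'I_n}}).

(** The sets [initial s 0], ..., [initial s n] form the full chain encoded by [s]. *)
Definition initial s j : {set 'I_n} := s @: [set i : 'I_n | i < j].

(** A full chain has exactly one member of each size, so only size [#|B|] needs testing. *)
Definition on_chain s B := initial s #|B| == B.

Lemma initialM s p j : initial (s * p)%g j = p @: initial s j.
Proof. by rewrite -imset_comp; apply: eq_imset => i; rewrite permM. Qed.

Lemma card_initial s j : j <= n -> #|initial s j| = j.
Proof.
move=> jn; rewrite card_imset; last exact: perm_inj.
by rewrite -sum1dep_card (big_ord_narrow jn) sum1_card card_ord.
Qed.

Lemma card_leq_n B : #|B| <= n.
Proof. by rewrite -[leqRHS]card_ord max_card. Qed.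

Lemma initialS s i j : i <= j -> initial s i \subset initial s j.
Proof.
move=> ij; apply/imsetS/subsetP => k; rewrite !inE => ki.
exact: leq_trans ij.
Qed.

Lemma on_chain_initial s A j : on_chain s A -> #|A| <= j -> A \subset initial s j.
Proof. by move=> /eqP sA Aj; rewrite -sA initialS. Qed.

Lemma initial_on_chain s C j : on_chain s C -> j <= #|C| -> initial s j \subset C.
Proof. by move=> /eqP sC jC; rewrite -sC initialS. Qed.

(** [A] and [C] are the least and greatest members of [F] on the chain, possibly equal; the pair
    labels the class of [s]. *)
Definition spans F A C s :=
  [&& A \in F, C \in F, on_chain s A, on_chain s C &
    [forall B in F, on_chain s B ==> (A \subset B) && (B \subset C)]].

Lemma spansP F A C s : spans F A C s ->
  [/\ [/\ A \in F, C \in F & A \subset C], on_chain s A, on_chain s C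
    & forall B, B \in F -> on_chain s B -> A \subset B /\ B \subset C].
Proof.
case/and5P=> AF CF sA sC /forall_inP h.
have {}h B : B \in F -> on_chain s B -> A \subset B /\ B \subset C.
  by move=> BF sB; apply/andP/(implyP (h B BF)).
by have [AC _] := h _ CF sC.
Qed.

Lemma spans_exists F s B :
  B \in F -> on_chain s B -> exists A C, spans F A C s.
Proof.
move=> BF sB; pose P X := (X \in F) && on_chain s X.
have PB : P B by rewrite /P BF.
have [A /andP[AF sA] minA] := arg_minnP (fun X : {set 'I_n} => #|X|) PB.
have [C /andP[CF sC] maxC] := arg_maxnP (fun X : {set 'I_n} => #|X|) PB.
exists A, C; rewrite /spans AF CF sA sC; apply/forall_inP => X XF.
apply/implyP => sX; have PX : P X by rewrite /P XF.
rewrite -(eqP sX); apply/andP; split.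
  by apply: on_chain_initial => //; apply: minA.
by apply: initial_on_chain => //; apply: maxC.
Qed.

Lemma spans_unique F A C A' C' s :
  spans F A C s -> spans F A' C' s -> (A, C) = (A', C').
Proof.
move=> /spansP[[AF CF _] sA sC h] /spansP[[A'F C'F _] sA' sC' h'].
by congr (_, _); apply/eqP; rewrite eqEsubset;
  have [? ?] := h _ A'F sA'; have [? ?] := h _ C'F sC';
  have [? ?] := h' _ AF sA; have [? ?] := h' _ CF sC; apply/andP.
Qed.

(** Such a [p] fixes setwise every subset of [A] and every superset of [C], so the chain changes
    only strictly between [A] and [C]. *)
Lemma spans_mul F A C s p :
  perm_on (C :\: A) p -> spans F A C s -> spans F A C (s * p)%g.
Proof.
move=> pD /spansP[[AF CF AC] sA sC h].
have fixA (X : {set 'I_n}) : X \subset A -> p @: X = X.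
  move=> XA; apply: (im_perm_on_disjoint pD).
  rewrite disjoint_sym; apply/(disjointWr XA).
  by rewrite -setI_eq0 setIC setDE setIC -setIA [~: A :&: A]setIC setICr setI0.
have fixC (X : {set 'I_n}) : C \subset X -> p @: X = X.
  by move=> CX; apply: (im_perm_on_super pD); rewrite subDset subsetU // CX orbT.
have memA : on_chain (s * p)%g A by rewrite /on_chain initialM (eqP sA) fixA.
have memC : on_chain (s * p)%g C by rewrite /on_chain initialM (eqP sC) fixC.
rewrite /spans AF CF memA memC /=; apply/forall_inP => B BF; apply/implyP => memB.
(* A member [B] no larger than [A], or larger than [C], was already on the old chain; any other is
   nested between [A] and [C] by size. *)
have [BA|AB] := leqP #|B| #|A|.
  have sB : on_chain s B.
    move: memB; rewrite /on_chain initialM fixA //; exact: initial_on_chain.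
  by apply/andP; apply: h.
have [BC|CB] := leqP #|B| #|C|.
  by rewrite -(eqP memB) (on_chain_initial memA (ltnW AB)) initial_on_chain.
have sB : on_chain s B.
  by move: memB; rewrite /on_chain initialM fixC //; apply: on_chain_initial sC (ltnW CB).
by apply/andP; apply: h.
Qed.

(** If [X] is the chain member of size [#|B|], then [p] puts [B] on the chain only by carrying
    [X :&: D] to [B :&: D]. *)
Lemma card_interval_chains s A B C :
  on_chain s A -> on_chain s C -> A \subset B -> B \subset C ->
  #|[set p | perm_on (C :\: A) p & on_chain (s * p)%g B]|
    * 'C(#|C :\: A|, #|B| - #|A|) <= #|C :\: A|`!.
Proof.
move=> sA sC AB BC; set D := C :\: A; set X := initial s #|B|.
have AX : A \subset X by rewrite on_chain_initial ?subset_leq_card.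
have XC : X \subset C by rewrite initial_on_chain ?subset_leq_card.
have cardD (Y : {set 'I_n}) : A \subset Y -> Y \subset C -> #|Y :&: D| = #|Y| - #|A|.
  by move=> AY YC; rewrite /D setIDA (setIidPl YC) cardsD (setIidPr AY).
have cX : #|X :&: D| = #|B| - #|A| by rewrite cardD // card_initial // card_leq_n.
rewrite -cX -(@card_perms_onto _ D (X :&: D) (B :&: D)) ?subsetIr ?cX ?cardD //.
rewrite leq_mul2r; apply/orP; right; apply/subset_leq_card/subsetP => p.
rewrite !inE /on_chain initialM => /andP[pD /eqP pX]; rewrite pD /=.
rewrite imsetI; last by move=> ? ? _ _; apply: perm_inj.
by rewrite pX (im_perm_on pD).
Qed.

(** This is [card_perms_onto] with [D = setT], applied to the first [#|B|] points. *)
Lemma card_chains_through B :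
  #|[set s : 'S_n | on_chain s B]| * 'C(n, #|B|) = n`!.
Proof.
have eX : #|initial 1%g #|B| | = #|B| by rewrite card_initial // card_leq_n.
have := @card_perms_onto _ setT (initial 1%g #|B|) B.
rewrite !subsetT eX cardsT card_ord => <- //; congr (_ * _).
apply: eq_card => s; rewrite !inE -initialM mul1g.
by have -> : perm_on setT s by apply/subsetP => x; rewrite inE.
Qed.

(** * Averaging over shuffles, over classes, and over all chains *)

Lemma level_lt m F A C j :
  ~ has_level_diamond m F -> A \in F -> C \in F -> #|A| < j < #|C| ->
  #|[set B in F | (A \subset B) && (B \subset C) && (#|B| == j)]| < m.
Proof.
move=> noF AF CF /andP[Aj jC]; rewrite ltnNge; apply/negP => /card_geqP[b [ub sb bP]].
have bE B : B \in b -> [/\ B \in F, A \subset B, B \subset C & #|B| = j].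
  by move=> /bP; rewrite inE => /andP[? /andP[/andP[? ?] /eqP]].
apply: noF; exists A, C, (Tuple (introT eqP sb)).
have memb i : tnth (Tuple (introT eqP sb)) i \in b by apply: mem_tnth.
split=> [|B|i|i i'].
(* The strict size inequalities keep [A], [C] and the members of [b] distinct. *)
- rewrite /= mem_rcons rcons_uniq ub inE negb_or andbT -andbA; apply/and3P; split.
  + by apply/eqP => eqAC; move: (ltn_trans Aj jC); rewrite eqAC ltnn.
  + by apply/negP => /bE[_ _ _ eA]; rewrite eA ltnn in Aj.
  + by apply/negP => /bE[_ _ _ eC]; rewrite eC ltnn in jC.
- by rewrite inE mem_rcons inE => /or3P[/eqP->|/eqP->|/bE[]].
- by have [_ ? ? _] := bE _ (memb i).
- by have [_ _ _ ->] := bE _ (memb i); have [_ _ _ ->] := bE _ (memb i').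
Qed.

Lemma interval_mean m F A C s k :
  ~ has_level_diamond m F -> m.-1 <= 3 ^ k -> spans F A C s ->
  \sum_(p : 'S_n | perm_on (C :\: A) p) \sum_(B in F) on_chain (s * p)%g B
    <= 3 * k.+1 * #|C :\: A|`!.
Proof.
move=> noF mk sP; have [[AF CF AC] sA sC _] := spansP sP.
set D := C :\: A; have cD : #|D| = #|C| - #|A| by rewrite cardsD (setIidPr AC).
pose w B := #|[set p | perm_on D p & on_chain (s * p)%g B]|.
pose lev i := [set B in F | (A \subset B) && (B \subset C) && (#|B| == #|A| + i)].
have levP i B : B \in lev i ->
    [/\ B \in F, A \subset B, B \subset C & #|B| = #|A| + i].
  by rewrite inE => /andP[? /andP[/andP[? ?] /eqP]].
have lev_sum i : 'C(#|D|, i) * (\sum_(B in lev i) w B) <= #|lev i| * #|D|`!.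
  rewrite big_distrr /= -sum_nat_const; apply: leq_sum => B /levP[_ AB BC eB].
  have := card_interval_chains sA sC AB BC.
  by rewrite eB addKn mulnC.
(* [B] is recovered from [B :\: A], an [i]-subset of [D]. *)
have lev_bin i : #|lev i| <= 'C(#|D|, i).
  rewrite -cards_draws -(@card_in_imset _ _ (fun B => B :\: A) (lev i)).
    apply/subset_leq_card/subsetP => _ /imsetP[B /levP[_ AB BC eB] ->].
    by rewrite inE setSD //= cardsD (setIidPr AB) eB addKn.
  move=> X Y /levP[_ AX _ _] /levP[_ AY _ _] eXY.
  by rewrite -(setID X A) -(setID Y A) eXY (setIidPr AX) (setIidPr AY).
have lev_diamond i : 0 < i < #|D| -> #|lev i| <= 3 ^ k.
  move=> /andP[i0 id]; apply: leq_trans mk.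
  have : #|lev i| < m by apply: level_lt noF AF CF _; lia.
  lia.
(* By [spans_mul], members of [F] on a shuffled chain stay between [A] and [C], so sorting by level
   loses none. *)
apply: (@leq_trans (\sum_(0 <= i < #|D|.+1) \sum_(B in lev i) w B)).
  rewrite exchange_big /=.
  rewrite big_mkord [leqRHS](exchange_big_dep (mem F)) /=; last by move=> i B _ /levP[].
  apply: leq_sum => B BF; rewrite sum_bool_card -/(w B).
  have [w0|[p]] := set_0Vmem [set p | perm_on D p & on_chain (s * p)%g B].
    by rewrite /w w0 cards0.
  rewrite inE => /andP[pD pB].
  have [_ _ _ /(_ B BF pB)[AB BC]] := spansP (spans_mul pD sP).
  have iD : #|B| - #|A| < #|D|.+1 by rewrite cD ltnS leq_sub2r ?subset_leq_card.
  rewrite (bigD1 (Ordinal iD)) ?leq_addr //=.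
  by rewrite inE BF AB BC subnKC ?eqxx ?subset_leq_card.
apply: level_sum_bound => [i iD|kD i /andP[ki iDk]].
  have bin_pos : 0 < 'C(#|D|, i) by rewrite bin_gt0.
  rewrite -(leq_pmul2l bin_pos); apply: leq_trans (lev_sum i) _.
  by rewrite leq_mul2r lev_bin orbT.
have bin_pos : 0 < 'C(#|D|, i) by rewrite bin_gt0; lia.
have h1 := lev_sum i; have h2 := @lev_diamond i ltac:(lia).
have h3 := @middle_bin_lower_bound #|D| k i kD ltac:(lia).
rewrite -(leq_pmul2l bin_pos) mulnCA.
apply: (@leq_trans ((#|D| - k) * (3 ^ k * #|D|`!))).
  by rewrite leq_mul2l (leq_trans h1) ?orbT // leq_mul2r h2 orbT.
by rewrite mulnA [_ * 3 ^ k]mulnC mulnA ['C(_, _) * _]mulnC leq_mul2r h3 orbT.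
Qed.

(** Each shuffle permutes the class, so averaging over all shuffles leaves the class sum unchanged,
    and [interval_mean] applies to each [s]. *)
Lemma class_mean m F A C k :
  ~ has_level_diamond m F -> m.-1 <= 3 ^ k ->
  \sum_(s | spans F A C s) \sum_(B in F) on_chain s B
    <= 3 * k.+1 * #|[set s | spans F A C s]|.
Proof.
move=> noF mk; rewrite -(leq_pmul2l (fact_gt0 #|C :\: A|)).
apply: (@leq_trans (\sum_(s | spans F A C s)
    \sum_(p : 'S_n | perm_on (C :\: A) p) \sum_(B in F) on_chain (s * p)%g B)).
  rewrite [leqRHS]exchange_big /= -card_perm -sum_nat_const; apply: leq_sum => p pD.
  rewrite (reindex_inj (mulIg p)) /=; apply: eq_leq; apply: eq_bigl => s.
  apply/idP/idP => [|/(spans_mul pD)//].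
  by move=> /(spans_mul (perm_onV pD)); rewrite mulgK.
apply: (@leq_trans (\sum_(s | spans F A C s) 3 * k.+1 * #|C :\: A|`!)).
  by apply: leq_sum => s; apply: interval_mean noF mk.
by rewrite sum_nat_const -cardsE mulnC [X in _ <= X]mulnCA mulnA.
Qed.

Lemma chain_mean m F k :
  ~ has_level_diamond m F -> m.-1 <= 3 ^ k ->
  \sum_s \sum_(B in F) on_chain s B <= 3 * k.+1 * n`!.
Proof.
move=> noF mk.
apply: (@leq_trans (\sum_(AC : {set 'I_n} * {set 'I_n})
    \sum_(s | spans F AC.1 AC.2 s) \sum_(B in F) on_chain s B)).
  rewrite [leqRHS](exchange_big_dep predT) //=; apply: leq_sum => s _.
  (* A chain that misses [F] lies in no class but contributes zero. *)
  have [/existsP[B /andP[BF sB]]|noB] := boolP [exists B, (B \in F) && on_chain s B].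
    have [A [C sAC]] := spans_exists BF sB.
    by rewrite (bigD1 (A, C)) //= leq_addr.
  rewrite big1 // => B BF; apply/eqP; rewrite eqb0.
  by move: noB; rewrite negb_exists => /forallP/(_ B); rewrite BF.
apply: (@leq_trans (\sum_(AC : {set 'I_n} * {set 'I_n})
    3 * k.+1 * #|[set s | spans F AC.1 AC.2 s]|)).
  by apply: leq_sum => AC _; apply: class_mean noF mk.
(* The classes are disjoint by [spans_unique], so their sizes add up to at most the number of
   permutations. *)
rewrite -big_distrr /= leq_mul2l; apply/orP; right.
under eq_bigr do rewrite -sum1dep_card.
rewrite (exchange_big_dep predT) //= -[leqRHS]card_Sn -[leqRHS]sum1_card.
apply: leq_sum => s _; rewrite sum1dep_card; apply/card_le1_eqP => -[A C] [A' C'].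
by rewrite !inE /= => sAC sAC'; apply: spans_unique sAC' sAC.
Qed.

End FullChains.

Theorem theorem2p22 (n m : nat) (F : {set {set 'I_n}}) (hm : 2 <= m)
    (hF : ~ has_level_diamond m F) :
  #|F| <= 3 * (up_log 3 (m - 1) + 1) * 'C(n, n %/ 2).
Proof.
set k := up_log 3 (m - 1).
have mk : m.-1 <= 3 ^ k by rewrite -subn1 up_logP.
rewrite -(leq_pmul2l (fact_gt0 n)).
(* Each [B] lies on a fraction [1 / 'C(n, #|B|)] of the chains, hence at least
   [1 / 'C(n, n %/ 2)]. *)
apply: (@leq_trans ('C(n, n %/ 2) * \sum_(s : 'S_n) \sum_(B in F) on_chain s B)).
  rewrite exchange_big /= big_distrr /= mulnC -sum_nat_const.
  apply: leq_sum => B _; rewrite -(card_chains_through B) mulnC.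
  by rewrite sum_bool_card /= leq_mul2r leq_bin_half ?orbT // card_leq_n.
rewrite mulnA mulnC leq_mul2r addn1 [_`! * _]mulnC; apply/orP; right.
exact: chain_mean hF mk.
Qed.
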